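(* Let $t<0$ in $\mathbb{R}$. Then the map $\|\cdot\|_t:\mathbb{H}_t\to\mathbb{R}$, $\|h\|_t=\sqrt{\langle h,h\rangle_t}$, is a norm on $\mathbb{H}_t$ over $\mathbb{R}$. Furthermore, $\mathbb{H}_t$ is complete under $\|\cdot\|_t$, i.e., $(\mathbb{H}_t,\|\cdot\|_t)$ is a Banach space over $\mathbb{R}$. Equivalently, the real inner product space $(\mathbb{H}_t,\langle\cdot,\cdot\rangle_t)$ is a Hilbert space over $\mathbb{R}$.
   Context: For $t\in\mathbb{R}$, the $t$-scaled hypercomplex ring $\mathbb{H}_t$ is the set $\mathbb{C}^2$ with the usual vector addition and the multiplication $(a_1,b_1)\cdot_t(a_2,b_2)=(a_1a_2+t\,b_1\overline{b_2},\;a_1b_2+b_1\overline{a_2})$; it is regarded as a vector space over $\mathbb{R}$. Set $(a,b)^{\dagger}=(\overline{a},-b)$, $\tau((a,b))=\mathrm{Re}(a)$, and $\langle h_1,h_2\rangle_t=\tau(h_1\cdot_t h_2^{\dagger})\in\mathbb{R}$ for $h_1,h_2\in\mathbb{H}_t$; for $t<0$ this is an inner product on $\mathbb{H}_t$ over $\mathbb{R}$. *)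

(* Defs.v *)
From HB Require Import structures.
From mathcomp Require Import all_boot all_order all_algebra.
From mathcomp Require Import ring.
From mathcomp Require Import all_classical all_reals all_analysis.
From mathcomp Require Import complex.

Set Implicit Arguments.
Unset Strict Implicit.
Unset Printing Implicit Defensive.

Import Order.TTheory GRing.Theory Num.Theory.
Import numFieldNormedType.Exports.

Local Open Scope ring_scope.
Local Open Scope complex_scope.

(* The parameter [t] only selects the multiplication put on the pairs; indexing
   the type by it keeps that ring structure apart from the one on products. *)
Definition hypercomplex (R : realType) (t : R) : Type := (R[i] * R[i])%type.

Section HypercomplexRing.
Variables (R : realType) (t : R).

(* [Rcomplex R] is [R[i]] viewed as a vector space over [R]. *)
HB.instance Definition _ := GRing.Lmodule.copy (hypercomplex t)
  (Rcomplex R * Rcomplex R)%type.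

Local Notation H := (hypercomplex t).

Lemma hscaleE (r : R) (h : H) : r *: h = (r%:C * h.1, r%:C * h.2) :> H.
Proof.
by case: h => -[a b] [c d]; congr (_, _); apply/eqP;
  rewrite eq_complex /= !mul0r subr0 addr0 !eqxx.
Qed.

Definition hmul (h1 h2 : H) : H :=
  (h1.1 * h2.1 + t%:C * (h1.2 * conjc h2.2), h1.1 * h2.2 + h1.2 * conjc h2.1).

Definition hone : H := (1, 0).

Lemma hyper_eq (h k : H) : h.1 = k.1 -> h.2 = k.2 -> h = k.
Proof. by case: h k => a b [c d] /= -> ->. Qed.

Lemma complex_eq (x y : R[i]) : complex.Re x = complex.Re y ->
  complex.Im x = complex.Im y -> x = y.
Proof. by case: x y => a b [c d] /= -> ->. Qed.

Lemma hmulA : associative hmul.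
Proof.
move=> [[a b] [c d]] [[a' b'] [c' d']] [[a1 b1] [c1 d1]].
by apply: hyper_eq; apply: complex_eq => /=; ring.
Qed.

Lemma hmul1 : left_id hone hmul.
Proof. by move=> [[a b] [c d]]; apply: hyper_eq; apply: complex_eq => /=; ring. Qed.

Lemma hmulr1 : right_id hone hmul.
Proof. by move=> [[a b] [c d]]; apply: hyper_eq; apply: complex_eq => /=; ring. Qed.

Lemma hmulDl : left_distributive hmul +%R.
Proof.
move=> [[a b] [c d]] [[a' b'] [c' d']] [[a1 b1] [c1 d1]].
by apply: hyper_eq; apply: complex_eq => /=; ring.
Qed.

Lemma hmulDr : right_distributive hmul +%R.
Proof.
move=> [[a b] [c d]] [[a' b'] [c' d']] [[a1 b1] [c1 d1]].
by apply: hyper_eq; apply: complex_eq => /=; ring.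
Qed.

Lemma hone_neq0 : hone != 0 :> H.
Proof. by apply/eqP => -[/eqP]; rewrite oner_eq0. Qed.

HB.instance Definition _ := GRing.Zmodule_isNzRing.Build H
  hmulA hmul1 hmulr1 hmulDl hmulDr hone_neq0.

Definition hdagger (h : H) : H := (conjc h.1, - h.2).

Definition htau (h : H) : R := complex.Re h.1.

Definition hform (h1 h2 : H) : R := htau (h1 * hdagger h2).

Definition hnorm (h : H) : R := Num.sqrt (hform h h).

End HypercomplexRing.

Arguments hform {R} t h1 h2.
Arguments hnorm {R} t h.

Record is_norm (R : realType) (V : lmodType R) (N : V -> R) : Prop := IsNorm {
  is_norm_ge0 : forall v, 0 <= N v;
  is_norm_eq0 : forall v, N v = 0 <-> v = 0;
  is_normZ : forall (r : R) v, N (r *: v) = `|r| * N v;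
  is_normD : forall v w, N (v + w) <= N v + N w
}.

(* [(V, N)] is Banach when it consists of the underlying vector space and the
   norm of a [completeNormedModType]. *)
Inductive is_banach (R : realType) :
    forall V : lmodType R, (V -> R) -> Prop :=
  | IsBanach (B : completeNormedModType R) :
      @is_banach R B (fun v : B => `|v|).

(* Over the reals, [{dot V for idfun}] is the library's type of symmetric
   positive definite bilinear forms on [V]. *)
Definition is_inner_product (R : realType) (V : lmodType R)
    (ip : V -> V -> R) : Prop :=
  exists f : {dot V for idfun}, forall v w, f v w = ip v w.

Definition is_hilbert (R : realType) (V : lmodType R)
    (ip : V -> V -> R) : Prop :=
  is_inner_product ip /\ is_banach (fun v => Num.sqrt (ip v v)).

(* Main.v *)
From HB Require Import structures.
Require Import Defs.
From mathcomp Require Import all_boot all_order all_algebra.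
From mathcomp Require Import ring.
From mathcomp Require Import all_classical all_reals all_analysis.
From mathcomp Require Import complex.

Set Implicit Arguments.
Unset Strict Implicit.
Unset Printing Implicit Defensive.

Import Order.TTheory GRing.Theory Num.Theory.
Import numFieldNormedType.Exports.

Local Open Scope ring_scope.

(** Writing [h = (a, b)], the square norm is [|a|^2 - t |b|^2], so for
    [t < 0] the form is positive definite and the map
    [h |-> (Re a, Im a, sqrt(-t) Re b, sqrt(-t) Im b)] carries it to the
    standard inner product of [R^4].  Everything follows from this.

    - The square root of a positive definite symmetric form is a norm, by the
      Cauchy-Schwarz inequality ([dot_is_norm]).
    - Completeness goes back along a linear bijection that is Lipschitz in both
      directions ([is_banach_bilipschitz]).  The coordinate map [hcoord] is one,
      because the Euclidean norm on row vectors lies between the sup norm and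
      [sqrt n] times it, and row vectors are complete for the sup norm. *)

Section InnerProductNorm.
Variables (R : realType) (V : lmodType R) (f : {dot V for idfun}).

Lemma dotC u v : f u v = f v u.
Proof. by rewrite (hermitian_subproof (s := f) u v) expr0 mul1r. Qed.

Lemma dot0r u : f u 0 = 0.
Proof. exact: linear0r. Qed.

Lemma dot_ge0 u : 0 <= f u u.
Proof.
have [->|/neq0_dnorm_gt0/ltW->//] := eqVneq u 0.
by rewrite dot0r.
Qed.

Lemma dotDr u v w : f u (v + w) = f u v + f u w.
Proof. exact: linearDr. Qed.

Lemma dotZr a u v : f u (a *: v) = a * f u v.
Proof. exact: linearZr_LR. Qed.

Lemma dotDl u v w : f (u + v) w = f u w + f v w.
Proof. by rewrite !(dotC _ w) dotDr. Qed.

Lemma dotZl a u v : f (a *: u) v = a * f u v.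
Proof. by rewrite !(dotC _ v) dotZr. Qed.

Lemma dotDD u v : f (u + v) (u + v) = f u u + 2 * f u v + f v v.
Proof. by rewrite dotDr !dotDl (dotC v u); ring. Qed.

Lemma dotZZ a u : f (a *: u) (a *: u) = a ^+ 2 * f u u.
Proof. by rewrite dotZr dotZl expr2 mulrA. Qed.

(** The vector [<v, v> u - <u, v> v] is orthogonal to [v]; its square norm is
    [<v, v>] times the difference of the two sides. *)
Lemma dot_CauchySchwarz u v : f u v ^+ 2 <= f u u * f v v.
Proof.
have [->|v0] := eqVneq v 0; first by rewrite !dot0r expr0n mulr0.
have fv_gt0 := neq0_dnorm_gt0 (s := f) _ v0.
have := dot_ge0 (f v v *: u + (- f u v) *: v).
rewrite dotDD !dotZZ dotZr dotZl.
have -> : f v v ^+ 2 * f u u + 2 * (- f u v * (f v v * f u v)) +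
  (- f u v) ^+ 2 * f v v = f v v * (f u u * f v v - f u v ^+ 2) by ring.
by rewrite pmulr_rge0// subr_ge0.
Qed.

Lemma dot_is_norm : is_norm (fun v => Num.sqrt (f v v)).
Proof.
split=> [v|v|r v|v w].
- exact: sqrtr_ge0.
- split=> [/eqP|->]; last by rewrite dot0r sqrtr0.
  rewrite sqrtr_eq0 => fv_le0; apply/eqP; apply: contraTT fv_le0 => v0.
  by rewrite -ltNge (neq0_dnorm_gt0 (s := f)).
- by rewrite dotZZ sqrtrM ?sqr_ge0// sqrtr_sqr.
- rewrite -[leRHS]ger0_norm ?addr_ge0 ?sqrtr_ge0// -sqrtr_sqr ler_wsqrtr//.
  rewrite sqrrD !sqr_sqrtr ?dot_ge0// dotDD -[in leRHS]mulr_natl lerD2r.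
  rewrite lerD2l ler_wpM2l//.
  rewrite (le_trans (ler_norm _))// -sqrtrM ?dot_ge0// -sqrtr_sqr.
  by rewrite ler_wsqrtr// dot_CauchySchwarz.
Qed.

End InnerProductNorm.

(** A copy of [V] that remembers a proof that [N] is a norm, so that the topology
    of [N] can be attached to it as a canonical structure without competing
    with one that [V] may carry already. *)
Definition normed_by (R : realType) (V : lmodType R) (N : V -> R)
  (hN : is_norm N) : Type := V.

Section NormedBy.
Variables (R : realType) (V : lmodType R) (N : V -> R) (hN : is_norm N).

HB.instance Definition _ := GRing.Lmodule.copy (normed_by hN) V.

Let N0_eq0 v : N v = 0 -> v = 0.
Proof. by move/(is_norm_eq0 hN). Qed.

HB.instance Definition _ := Lmodule_isNormed.Build R (normed_by hN)
  (is_normD hN) (is_normZ hN) N0_eq0.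

End NormedBy.

(** [is_banach] asks for a complete normed module whose underlying vector space
    is [V] itself: isomorphism is not enough, so [V] is equipped with the
    topology of [N] in place rather than transported to another space. *)
Lemma is_banach_complete (R : realType) (V : lmodType R) (N : V -> R)
    (hN : is_norm N) :
  (forall F : set_system (normed_by hN), ProperFilter F -> cauchy F -> cvg F) ->
  is_banach N.
Proof.
(* [V] is taken apart because structures have no eta-conversion: the vector
   space read back from [B] is convertible to [V] only once [V] is in
   constructor form. *)
case: V N hN => V [m1 m2 m3 m4 m5 m6 m7 m8 m9 m10] N hN cpl.
pose B : completeNormedModType R := HB.pack (normed_by hN)
  (Uniform_isComplete.Build (normed_by hN) cpl).
exact: (IsBanach B).
Qed.

Local Open Scope classical_set_scope.

(** A Cauchy filter for [N] is sent by [f] to a Cauchy filter of [W], because [f]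
    is Lipschitz; if that one tends to [w], the filter tends to [g w], because
    [N] is controlled by the norm of the image. *)
Lemma is_banach_bilipschitz (R : realType) (V : lmodType R) (N : V -> R)
    (W : completeNormedModType R) (f : {linear V -> W}) (g : W -> V)
    (C D : R) :
  is_norm N -> cancel g f -> 0 < C -> 0 < D ->
  (forall v, `|f v| <= C * N v) -> (forall v, N v <= D * `|f v|) ->
  is_banach N.
Proof.
move=> hN gK C0 D0 f_le N_le; apply: (@is_banach_complete _ _ _ hN) => F FF.
move=> /cauchyP Fc.
have /cauchy_cvg/cvg_ex[/= w /cvg_ballP fF] : cauchy (f @ F).
  apply/cauchyP => e e0; have [v Fv] := Fc _ (divr_gt0 e0 C0).
  exists (f v); rewrite /fmap/=; apply: filterS Fv => u; rewrite -!ball_normE/=.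
  rewrite -(linearB f).
  by rewrite ltr_pdivlMr// mulrC => /(le_lt_trans (f_le _)).
apply/cvg_ex; exists (g w); apply/cvg_ballP => e e0.
apply: filterS (fF _ (divr_gt0 e0 D0)) => v; rewrite -!ball_normE/=.
rewrite -[in X in X -> _](gK w) -(linearB f) ltr_pdivlMr// mulrC.
exact: le_lt_trans (N_le _).
Qed.

Local Close Scope classical_set_scope.

(** Completeness and the norm of matrices come as separate structures; only this
    join makes row vectors a possible target for the coordinate map. *)
HB.instance Definition _ (R : realType) m n := Complete.on 'M[R]_(m, n).

Lemma row_norm_le_euclid (R : realType) n (w : 'rV[R]_n) :
  `|w| <= Num.sqrt (\sum_i w 0 i ^+ 2).
Proof.
have [->|/mx_norm_neq0[[k i] /=]] := eqVneq `|w| 0; first exact: sqrtr_ge0.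
rewrite ord1 => wE; rewrite [leLHS]wE -sqrtr_sqr ler_wsqrtr// (bigD1 i)//= lerDl sumr_ge0// => j _.
exact: sqr_ge0.
Qed.

Lemma euclid_le_row_norm (R : realType) n (w : 'rV[R]_n) :
  Num.sqrt (\sum_i w 0 i ^+ 2) <= Num.sqrt n%:R * `|w|.
Proof.
rewrite -[X in _ * X]ger0_norm// -[X in _ * X]sqrtr_sqr -sqrtrM// ler_wsqrtr//.
rewrite mulr_natl -[X in _ *+ X]card_ord -sumr_const ler_sum// => i _.
rewrite -[leLHS]real_normK ?num_real// ler_pXn2r ?nnegrE//.
rewrite -[`|w|]/(mx_norm w) mx_normrE.
exact: (le_bigmax _ (fun ij : 'I_1 * 'I_n => `|w ij.1 ij.2|) (ord0, i)).
Qed.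

Section Hypercomplex.
Variables (R : realType) (t : R).
Local Notation H := (hypercomplex t).
Local Notation Re := complex.Re.
Local Notation Im := complex.Im.

Lemma hformE (h k : H) : hform t h k =
  Re h.1 * Re k.1 + Im h.1 * Im k.1 - t * (Re h.2 * Re k.2 + Im h.2 * Im k.2).
Proof. by case: h k => [[a b] [c d]] [[a' b'] [c' d']]; rewrite /hform/htau/=; ring. Qed.

Lemma hform_linear (h : H) : scalar (hform t h).
Proof.
move=> r [[a b] [c d]] [[a' b'] [c' d']]; rewrite !hformE.
by case: h => [[x y] [z u]]; rewrite hscaleE /=; ring.
Qed.

Lemma hformC (h k : H) : hform t h k = hform t k h.
Proof. by rewrite !hformE; ring. Qed.

Lemma hform_gt0 (h : H) : t < 0 -> h != 0 -> 0 < hform t h h.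
Proof.
move=> t0; have t'0 : 0 < - t by rewrite oppr_gt0.
have -> : hform t h h = Re h.1 ^+ 2 + Im h.1 ^+ 2 +
    - t * (Re h.2 ^+ 2 + Im h.2 ^+ 2) by rewrite hformE; ring.
have sq_ge0 (x y : R) : 0 <= x ^+ 2 + y ^+ 2 by rewrite addr_ge0 ?sqr_ge0.
have tsq_ge0 (x y : R) : 0 <= - t * (x ^+ 2 + y ^+ 2).
  by apply: mulr_ge0 (ltW _) (sq_ge0 _ _).
rewrite lt_def addr_ge0// andbT; apply: contraNN.
rewrite paddr_eq0// mulf_eq0 (gt_eqF t'0)/=.
rewrite !paddr_eq0 ?sqr_ge0// !sqrf_eq0.
case: h => [[a b] [c d]]/= => /andP[/andP[/eqP-> /eqP->] /andP[/eqP-> /eqP->]].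
by [].
Qed.

(** The factor [sqrt(-t)] turns the weighted sum of squares [hform t h h] into an
    unweighted one. *)
Definition hcoord (h : H) : 'rV[R]_4 :=
  \row_i [:: Re h.1; Im h.1; Num.sqrt (- t) * Re h.2; Num.sqrt (- t) * Im h.2]`_i.

Definition hcoord_inv (w : 'rV[R]_4) : H :=
  ((w 0 (inord 0) +i* w 0 (inord 1))%C,
   (w 0 (inord 2) / Num.sqrt (- t) +i* (w 0 (inord 3) / Num.sqrt (- t)))%C).

Lemma hcoord_linear : linear hcoord.
Proof.
move=> r [[a b] [c d]] [[a' b'] [c' d']]; rewrite hscaleE.
by apply/rowP => -[[|[|[|[|//]]]] ?]; rewrite !mxE /=; ring.
Qed.

HB.instance Definition _ := GRing.isLinear.Build R H 'rV[R]_4 _ hcoord hcoord_linear.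

Lemma hcoord_invK : t < 0 -> cancel hcoord_inv hcoord.
Proof.
move=> t0 w; have s0 : Num.sqrt (- t) != 0 by rewrite sqrtr_eq0 -ltNge oppr_gt0.
apply/rowP => i; rewrite !mxE -[in RHS](inord_val i).
by case: i => [[|[|[|[|//]]]] ?] /=; rewrite // mulrC divfK.
Qed.

Lemma hnorm_hcoord (h : H) : t < 0 ->
  hnorm t h = Num.sqrt (\sum_i hcoord h 0 i ^+ 2).
Proof.
move=> t0; congr Num.sqrt; rewrite hformE !big_ord_recl big_ord0 !mxE /=.
by rewrite !exprMn sqr_sqrtr ?oppr_ge0 ?ltW//; ring.
Qed.

Lemma hform_is_inner_product : t < 0 -> is_inner_product (hform t).
Proof.
move=> t0.
have bil : bilinear_for *%R (idfun \; *%R) (hform t : H -> H -> R).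
  split=> h; last exact: hform_linear.
  by move=> r k l /=; rewrite !(hformC _ h) hform_linear.
have herm (h k : H) : hform t h k = (-1) ^+ false * idfun (hform t k h).
  by rewrite mul1r hformC.
have pos (h : H) := @hform_gt0 h t0.
pose f : {dot H for idfun} := HB.pack (hform t : H -> H -> R)
  (bilinear_isBilinear.Build R H H R _ _ (hform t) bil)
  (isHermitianSesquilinear.Build R H false idfun (hform t) herm)
  (isDotProduct.Build R H (hform t) pos).
by exists f.
Qed.

End Hypercomplex.

Theorem theorem4p13 (R : realType) (t : R) (t_lt0 : t < 0) :
  [/\ is_norm (hnorm t),
      is_banach (hnorm t) &
      is_hilbert (hform t)].
Proof.
have ip := hform_is_inner_product t_lt0.
have norm : is_norm (hnorm t).
  have [f fE] := ip.
  have -> : hnorm t = fun h => Num.sqrt (f h h) by apply/funext => h; rewrite fE.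
  exact: dot_is_norm.
have banach : is_banach (hnorm t).
  have := @is_banach_bilipschitz R (hypercomplex t) (hnorm t) 'rV[R]_4
    (@hcoord R t) (@hcoord_inv R t) 1 (Num.sqrt 4%:R) norm (hcoord_invK t_lt0).
  apply=> [//||h|h].
  - by rewrite sqrtr_gt0.
  - by rewrite mul1r hnorm_hcoord// row_norm_le_euclid.
  - by rewrite hnorm_hcoord// euclid_le_row_norm.
by split.
Qed.
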